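(* Let $S\in\mathcal{S}$. Then either $\lim_{n\to\infty} d\big(k^n(S),k^n(1)\big)=0$ or $\lim_{n\to\infty} d\big(k^n(S),k^n(10)\big)=0$.
   Context: $\mathcal{S}\subset\{0,1\}^{\mathbb{N}}$ is the set of binary sequences that are not eventually constant. For a positive integer $m$, let $[m]$ denote its binary representation, with no leading zeros. For a binary sequence or finite string $S=r_1r_2\cdots$, decompose it into maximal runs $r_i$ of a repeated bit $b_i$, with consecutive runs using different bits. The Knave map is $$k(S)=[|r_1|]\,\overline{b_1}\,[|r_2|]\,\overline{b_2}\cdots,$$ where $\overline{b}$ is the complement of $b$; for a finite string this gives a finite string. Thus $k^n(1)$ and $k^n(10)$ are finite strings. A finite string is regarded as an element of $\{0,1\}^{\mathbb{N}}$ by appending infinitely many $1$s if it ends in $0$, and infinitely many $0$s if it ends in $1$. The metric on $\{0,1\}^{\mathbb{N}}$ is $d(S,S')=2^{-n}$ if $S\neq S'$ first differ at the $n$th bit, and $d(S,S)=0$. *)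

(* Defs.v *)
From HB Require Import structures.
From mathcomp Require Import all_boot all_order all_algebra.
From mathcomp Require Import all_classical all_reals all_analysis.

Set Implicit Arguments.
Unset Strict Implicit.
Unset Printing Implicit Defensive.

Import Order.TTheory GRing.Theory Num.Theory.
Import numFieldNormedType.Exports.

(* Bits are booleans (true = 1); sequences are indexed from 0, so that the n-th
   bit of the usual 1-based numbering is the value at n.-1. *)

Definition not_eventually_constant (S : nat -> bool) : Prop :=
  ~ exists (b : bool) (N : nat), forall n, N <= n -> S n = b.

(* Most significant bit first. For 0 < m there are trunc_log 2 m + 1 digits and
   the first one is 1. *)
Definition binary (m : nat) : seq bool :=
  let l := trunc_log 2 m in mkseq (fun i => odd (m %/ 2 ^ (l - i))) l.+1.

Definition knave_block (len : nat) (b : bool) : seq bool :=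
  rcons (binary len) (~~ b).

(* Run-length encoding: (length, repeated bit) of the successive maximal runs. *)
Fixpoint runs (s : seq bool) : seq (nat * bool) :=
  if s is b :: s' then
    if runs s' is (len, c) :: rs then
      if b == c then (len.+1, c) :: rs else (1, b) :: (len, c) :: rs
    else [:: (1, b)]
  else [::].

Definition knave_string (s : seq bool) : seq bool :=
  flatten [seq knave_block r.1 r.2 | r <- runs s].

(* The least m > n with S m != S n. The fallback value is only used when S is
   constant from n on. *)
Definition next_change (S : nat -> bool) (n : nat) : nat :=
  if pselect (exists m, (n < m) && (S m != S n)) is left h
  then ex_minn h else n.+1.

Definition run_start (S : nat -> bool) (i : nat) : nat :=
  iter i (next_change S) 0.

Definition run_block (S : nat -> bool) (i : nat) : seq bool :=
  knave_block (run_start S i.+1 - run_start S i) (S (run_start S i)).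

(* The infinite concatenation of the blocks: every block is nonempty, so the
   first n.+1 of them already determine the entry of index n. If S is not
   eventually constant, neither is knave S (the last bits of the blocks
   alternate), so iterates of knave on such S never meet the fallback value of
   next_change. *)
Definition knave (S : nat -> bool) : nat -> bool :=
  fun n => nth false (flatten (mkseq (run_block S) n.+1)) n.

(* A nonempty string followed by infinitely many copies of the complement of
   its last bit. *)
Definition extend (s : seq bool) : nat -> bool :=
  fun n => nth (~~ last true s) s n.

(* The exponent is the 1-based position of the first difference. *)
Definition dist (R : realType) (S T : nat -> bool) : R :=
  if pselect (exists i, S i != T i) is left h
  then (2 ^- (ex_minn h).+1)%R else 0%R.

(* Main.v *)
Require Import Defs.
From HB Require Import structures.
From mathcomp Require Import all_boot all_order all_algebra.
From mathcomp Require Import all_classical all_reals all_analysis.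
From mathcomp Require Import zify.

(** Complete runs of S determine complete blocks of k(S), and every block begins
    with 1. Writing lead m for the number of leading 1s of [m], the first run of
    an iterate evolves by m -> lead m until it is 1; from then on the iterates
    begin with 101 and the third run evolves by m -> 2 + lead m, which ends in
    the cycle 3, 4. When the third run is 4 the fourth is 1, and the fifth run
    evolves in two steps by m -> 3 + lead (2 + lead m), with fixed point 5. So
    every orbit, including that of the string 1, ends up alternating between the
    beginnings 10 1111 0 11111 0 and 10 111 000 111 0 1 0; the choice between
    k^n(1) and k^n(10) = k^(n+1)(1) matches the parities. From there, if two
    strings share a prefix with a given number of runs of 1s, their images share
    one with at least as many, because each block [m]0 contains a descent 10;
    the block [5]0 = 1010 contains two, so every second step gains a run. *)

Set Implicit Arguments.
Unset Strict Implicit.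
Unset Printing Implicit Defensive.

Import Order.TTheory GRing.Theory Num.Theory.
Import numFieldNormedType.Exports.

(** * Runs and the Knave map on finite strings *)

Lemma runs_head b s : exists l rs, runs (b :: s) = (l.+1, b) :: rs.
Proof.
elim: s b => [|c s IHs] b; first by exists 0, [::].
have [l [rs def_rs]] := IHs c.
rewrite [runs _]/= -/(runs (c :: s)) def_rs.
by case: eqP => [->|_]; [exists l.+1, rs | exists 0, ((l.+1, c) :: rs)].
Qed.

Lemma runs_cons b s : runs (b :: s) =
  if runs s is (len, c) :: rs then
    if b == c then (len.+1, c) :: rs else (1, b) :: (len, c) :: rs
  else [:: (1, b)].
Proof. by []. Qed.

Lemma runs_cat s b t :
  runs (rcons s b ++ ~~ b :: t) = runs (rcons s b) ++ runs (~~ b :: t).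
Proof.
elim: s => [|c s IHs].
  have [l [rs def_rs]] := runs_head (~~ b) t.
  by rewrite [rcons _ _]/= [_ ++ _]/= runs_cons def_rs; case: b def_rs.
rewrite rcons_cons cat_cons !runs_cons IHs.
have [d [u ->]] : exists d u, rcons s b = d :: u
  by case: s {IHs}; eexists; eexists.
have [l [rs ->]] := runs_head d u.
by rewrite cat_cons; case: (c == d).
Qed.

Lemma runs_nseq m b : runs (nseq m.+1 b) = [:: (m.+1, b)].
Proof. by elim: m => //= m ->; rewrite eqxx. Qed.

Lemma knave_string_cat s b t :
  knave_string (rcons s b ++ ~~ b :: t) =
  knave_string (rcons s b) ++ knave_string (~~ b :: t).
Proof. by rewrite /knave_string runs_cat map_cat flatten_cat. Qed.

Lemma knave_string_nseq m b : knave_string (nseq m.+1 b) = knave_block m.+1 b.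
Proof. by rewrite /knave_string runs_nseq /= cats0. Qed.

Lemma binary_head m : exists s, binary m.+1 = true :: s.
Proof.
rewrite /binary /= /mkseq /= subn0.
have /andP[lo hi] := @trunc_log_bounds 2 m.+1 isT isT.
suff -> : m.+1 %/ 2 ^ trunc_log 2 m.+1 = 1 by eexists.
apply/eqP; rewrite eqn_leq leq_divRL ?expn_gt0// mul1n lo andbT.
by rewrite -ltnS ltn_divLR ?expn_gt0// -expnS.
Qed.

Lemma knave_string_head b s : exists t, knave_string (b :: s) = true :: t.
Proof.
have [l [rs def_rs]] := runs_head b s.
rewrite /knave_string def_rs map_cons /knave_block [(_, _).1]/=.
by have [t ->] := binary_head l; eexists.
Qed.

(** The bit [~~ b] completes the last run of [rcons s b], so all blocks up to there are fixed; the
    extra 1 is the first digit of the next block. *)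
Lemma prefix_knave_string s b X : prefix (rcons (rcons s b) (~~ b)) X ->
  prefix (rcons (knave_string (rcons s b)) true) (knave_string X).
Proof.
move=> /prefixP[t ->]; rewrite cat_rcons knave_string_cat.
have [u ->] := knave_string_head (~~ b) t.
by rewrite -cat_rcons prefix_prefix.
Qed.

(** * Finite beginnings of infinite sequences and of their images *)

Definition starts (s : seq bool) (S : nat -> bool) : Prop :=
  forall i, i < size s -> nth false s i = S i.

Lemma starts_prefix s t S : prefix s t -> starts t S -> starts s S.
Proof.
move=> /prefixP[u ->] st i lti; rewrite -st ?nth_cat ?lti//.
by rewrite size_cat ltn_addr.
Qed.

Lemma starts_prefix_mkseq s S n : starts s S -> size s <= n ->
  prefix s (mkseq S n).
Proof.
move=> st le_n; apply/prefixP; exists (drop (size s) (mkseq S n)).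
rewrite -[LHS](cat_take_drop (size s)); congr (_ ++ _).
have sz : size (take (size s) (mkseq S n)) = size s.
  by rewrite size_takel// size_mkseq.
apply: (@eq_from_nth _ false) => // i; rewrite sz => lti.
by rewrite nth_take// nth_mkseq ?st//; apply: leq_trans lti le_n.
Qed.

Lemma starts_rcons s b S : starts s S -> S (size s) = b -> starts (rcons s b) S.
Proof.
move=> st Sb i; rewrite size_rcons ltnS nth_rcons leq_eqVlt => /orP[/eqP->|lti].
  by rewrite ltnn eqxx Sb.
by rewrite lti st.
Qed.

Lemma starts_extend s X : prefix s X -> starts s (extend X).
Proof.
move=> /prefixP[t ->] i lti; rewrite /extend nth_cat lti.
exact: set_nth_default.
Qed.

Section Streams.
Variable S : nat -> bool.
Hypothesis hS : not_eventually_constant S.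

Lemma later_change n b : exists m, (n <= m) && (S m != b).
Proof.
apply: contrapT => h; apply: hS; exists b, n => m le_nm.
by apply: contrapT => /eqP neq; apply: h; exists m; rewrite le_nm.
Qed.

Lemma next_changeP n :
  [/\ n < next_change S n, S (next_change S n) = ~~ S n
    & forall m, n <= m < next_change S n -> S m = S n].
Proof.
rewrite /next_change; case: pselect => [h|[]]; last first.
  by have [m /andP[]] := later_change n.+1 (S n); exists m; apply/andP.
case: ex_minnP => m /andP[lt_nm neq] min_m; split=> //.
  by move: neq; do 2 case: (S _).
move=> i /andP[]; rewrite leq_eqVlt => /orP[/eqP->//|lt_ni] lt_im.
apply/eqP/negPn/negP => neqi; have := min_m i.
by rewrite lt_ni neqi leqNgt lt_im => /(_ isT).
Qed.

Lemma run_startS i : run_start S i.+1 = next_change S (run_start S i).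
Proof. by []. Qed.

Lemma leq_run_start n : n <= run_start S n.
Proof.
elim: n => // n IHn; have [lt_n _ _] := next_changeP (run_start S n).
exact: leq_ltn_trans lt_n.
Qed.

Lemma mkseq_run_startS n : exists l,
  run_start S n.+1 - run_start S n = l.+1 /\
  mkseq S (run_start S n.+1) =
    mkseq S (run_start S n) ++ nseq l.+1 (S (run_start S n)).
Proof.
have [lt_n _ cst] := next_changeP (run_start S n).
rewrite -run_startS in lt_n cst *.
exists (run_start S n.+1 - run_start S n).-1.
have pos : 0 < run_start S n.+1 - run_start S n by rewrite subn_gt0.
rewrite (prednK pos); split=> //.
rewrite -{1}(subnKC (ltnW lt_n)) /mkseq iotaD map_cat add0n; congr (_ ++ _).
apply: (@eq_from_nth _ false); rewrite size_map size_iota ?size_nseq// => i lti.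
rewrite (nth_map 0) ?size_iota// nth_nseq lti nth_iota// cst//.
by rewrite leq_addr -ltn_subRL.
Qed.

Lemma mkseq_run_start_rcons n :
  exists s, mkseq S (run_start S n.+1) = rcons s (S (run_start S n)).
Proof.
have [l [_ ->]] := mkseq_run_startS n.
exists (mkseq S (run_start S n) ++ nseq l (S (run_start S n))).
by rewrite rcons_cat -cats1 -[[:: _]]/(nseq 1 _) -nseqD addn1.
Qed.

(** Cutting at a run boundary links the finite and the infinite map: the finite string then consists
    of exactly the first [n] runs, all complete. *)
Lemma knave_string_mkseq n : knave_string (mkseq S (run_start S n)) =
  flatten (mkseq (run_block S) n).
Proof.
elim: n => // n IHn; rewrite mkseqS flatten_rcons -IHn.
have [l [len ->]] := mkseq_run_startS n.
rewrite [run_block S n]/run_block len -knave_string_nseq.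
case: n {IHn len} => [|n]; first by [].
have [s ->] := mkseq_run_start_rcons n.
have [_ + _] := next_changeP (run_start S n); rewrite -run_startS => ->.
exact: knave_string_cat.
Qed.
End Streams.

Lemma size_knave_block m b : 1 < size (knave_block m b).
Proof. by rewrite size_rcons size_mkseq. Qed.

Lemma leq_size_flatten_blocks S n : n <= size (flatten (mkseq (run_block S) n)).
Proof.
elim: n => // n IHn; rewrite mkseqS flatten_rcons size_cat.
rewrite -addn1 leq_add//; apply: ltnW; exact: size_knave_block.
Qed.

Lemma starts_knave S n : starts (flatten (mkseq (run_block S) n)) (knave S).
Proof.
have pre a b : a <= b ->
    prefix (flatten (mkseq (run_block S) a)) (flatten (mkseq (run_block S) b)).
  by move/subnKC <-; rewrite /mkseq iotaD map_cat flatten_cat prefix_prefix.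
move=> i lti; rewrite /knave.
have lti' := leq_size_flatten_blocks S i.+1.
have [/pre/prefixP[t ->]|/ltnW/pre/prefixP[t ->]] := leqP n i.+1;
  by rewrite nth_cat ?lti ?lti'.
Qed.

Lemma not_eventually_constant_knave S :
  not_eventually_constant S -> not_eventually_constant (knave S).
Proof.
move=> hS [b [N cst]].
have last_bit n : N <= n -> ~~ S (run_start S n) = b.
  move=> leNn; pose F := flatten (mkseq (run_block S) n).
  have := @starts_knave S n.+1.
  rewrite mkseqS flatten_rcons -/F /run_block /knave_block -rcons_cat.
  (* [G] is the concatenation of the first [n.+1] blocks without its last bit, so that bit has index
     [size G], which is at least [n]. *)
  set G := (F ++ _) => /(_ (size G)).
  rewrite size_rcons ltnSn nth_rcons ltnn eqxx.
  move=> ->//; apply: cst; apply: leq_trans leNn _.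
  rewrite size_cat; apply: leq_trans (leq_addr _ _).
  exact: leq_size_flatten_blocks.
have [_ + _] := next_changeP hS (run_start S N).
have := last_bit N.+1 (leqnSn N); rewrite -run_startS => + eqS.
by rewrite eqS -(last_bit N (leqnn N)); case: (S _).
Qed.

Lemma not_eventually_constant_iter S n :
  not_eventually_constant S -> not_eventually_constant (iter n knave S).
Proof.
by move=> hS; elim: n => //= n; exact: not_eventually_constant_knave.
Qed.

(** Reduces iterates of [S] to finite strings: the cut of [S] at the start of run [size s] is long
    enough to have [s] as a prefix, and its image begins [knave S]. *)
Lemma starts_transfer S s s' : not_eventually_constant S ->
    (forall X, prefix s X -> prefix s' (knave_string X)) ->
  starts s S -> starts s' (knave S).
Proof.
move=> hS imp st; have le_s := leq_run_start hS (size s).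
apply: (starts_prefix (imp _ (starts_prefix_mkseq st le_s))).
by rewrite knave_string_mkseq//; exact: starts_knave.
Qed.

Lemma starts_run S s c : not_eventually_constant S -> starts (rcons s c) S ->
  exists m, starts (rcons (s ++ nseq m.+1 c) (~~ c)) S.
Proof.
move=> hS st.

case: (ex_minnP (later_change hS (size s) c)) => m /andP[le_m neq] min_m.
have Sc : S (size s) = c by rewrite -st ?size_rcons// nth_rcons ltnn eqxx.
have lt_m : size s < m.
  by rewrite ltn_neqAle le_m andbT; apply: contra neq => /eqP <-; rewrite Sc.
exists (m - size s).-1; rewrite prednK ?subn_gt0//.
apply: starts_rcons.
  move=> i; rewrite size_cat size_nseq subnKC// => lti; rewrite nth_cat.
  case: ltnP => lei.
    by rewrite -st ?nth_rcons ?lei// size_rcons; exact: ltnW.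
  rewrite nth_nseq ltn_sub2r//; apply/esym/eqP/negPn/negP => ni.
  by have := min_m i; rewrite lei ni leqNgt lti => /(_ isT).
rewrite size_cat size_nseq subnKC//.
by move: neq; case: (S m); case: (c).
Qed.

(** * Leading 1s of binary numerals and the dynamics they induce *)

Definition lead (m : nat) : nat := find negb (binary m).

(** The appended 0, which closes the block of a run of 1s, stops the leading 1s even when the
    numeral is all 1s. *)
Lemma prefix_find_negb s :
  prefix (rcons (nseq (find negb s) true) false) (rcons s false).
Proof. by elim: s => [|[] s IHs]; rewrite //= ?prefix0s// prefix_cons IHs. Qed.

Lemma lead_gt0 m : 0 < lead m.+1.
Proof. by rewrite /lead; have [s ->] := binary_head m. Qed.

Lemma leq_lead m : lead m <= (trunc_log 2 m).+1.
Proof. by apply: leq_trans (find_size _ _) _; rewrite size_mkseq. Qed.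

Lemma cat_nseqS (T : Type) (u : seq T) m b :
  u ++ nseq m.+1 b = rcons (u ++ nseq m b) b.
Proof. by elim: u => [|c u /= <-//]; elim: m => //= m ->. Qed.

Lemma knave_string_cat_nseq u m : last false u = false ->
  knave_string (u ++ nseq m.+1 true) =
  knave_string u ++ knave_block m.+1 true.
Proof.
rewrite -knave_string_nseq.
case/lastP: u => [//|u b]; rewrite last_rcons => ->.
exact: knave_string_cat.
Qed.

(** As [u] is empty or ends in 0, the 1s after it form a whole run, whose block begins with
    [lead m.+1] ones and then a 0. *)
Lemma prefix_knave_string_lead u m X : last false u = false ->
    prefix (rcons (u ++ nseq m.+1 true) false) X ->
  prefix (rcons (knave_string u ++ nseq (lead m.+1) true) false)
    (knave_string X).
Proof.
move=> last_u; rewrite {1}cat_nseqS => /prefix_knave_string.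
apply: prefix_trans; rewrite -cat_nseqS knave_string_cat_nseq// !rcons_cat.
rewrite prefix_catr// eqxx; apply: prefix_trans (prefix_rcons _ _).
exact: prefix_find_negb.
Qed.

(** Strict descent brings every orbit below [b]; the finitely many orbits from there are checked by
    computation. *)
Lemma iter_reach (f : nat -> nat) a b m :
    all (fun i => a \in traject f i b) (iota 0 b) ->
    (forall i, b <= i -> f i < i) ->
  exists n, iter n f m = a.
Proof.
move=> small large; elim/ltn_ind: m => m IHm.
have [lt_mb|le_bm] := ltnP m b.
  have /allP/(_ m) := small; rewrite mem_iota lt_mb.
  move=> /(_ isT)/trajectP[n _ ->].
  by exists n.
have [n <-] := IHm _ (large _ le_bm).
by exists n.+1; rewrite iterSr.
Qed.

Lemma trunc_log_lt n m : n < 2 ^ m -> 0 < n -> trunc_log 2 n < m.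
Proof.
move=> lt_n n_gt0; rewrite -(@ltn_exp2l 2)//.
by apply: leq_ltn_trans lt_n; apply: trunc_logP.
Qed.

Lemma leq_lead_add m c : 0 < m -> c + m < 2 ^ m -> lead (c + m) <= m.
Proof.
move=> m_gt0 lt_m; apply: leq_trans (leq_lead _) _.
by apply: trunc_log_lt; rewrite // addn_gt0 m_gt0 orbT.
Qed.

Lemma addn_lt_exp2 c m0 m : c + m0 < 2 ^ m0 -> m0 <= m -> c + m < 2 ^ m.
Proof.
move=> lt0 /subnKC <-; elim: (m - m0) => [|n IHn]; first by rewrite addn0.
by rewrite !addnS expnS; lia.
Qed.

(** From [c + m0] on, [m < 2 ^ (m - c)], so [m] has at most [m - c] digits. Hence a map adding less
    than [c] to [lead] descends strictly there. *)
Lemma leq_lead_sub c m0 m : c + m0 < 2 ^ m0 -> 0 < m0 -> c + m0 <= m ->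
  lead m + c <= m.
Proof.
move=> lt0 m0_gt0 le_m; have le_cm : c <= m by lia.
have : lead (c + (m - c)) <= m - c.
  by apply: leq_lead_add; [lia | apply: addn_lt_exp2 lt0 _; lia].
by rewrite subnKC//; lia.
Qed.

Lemma iter_lead m : exists n, (iter n lead m.+1) = 1.
Proof.
(* The map is conjugated by the successor to stay on positive numbers, since [lead 0] is 0. *)
have [||n def_n] := @iter_reach (fun i => (lead i.+1).-1) 0 3 m.
- by vm_compute.
- by move=> i le_i; have := @leq_lead_sub 1 2 i.+1; lia.
exists n; rewrite -[in RHS]def_n.
by elim: n {def_n} => //= n ->; rewrite prednK// lead_gt0.
Qed.

Lemma iter_lead_add2 m : exists n, iter n (fun i => (lead i).+2) m = 3.
Proof.
apply: (@iter_reach _ 3 6); first by vm_compute.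
by move=> i le_i; have := @leq_lead_sub 3 3 i; lia.
Qed.

Lemma iter_lead_add3 m :
  exists n, iter n (fun i => (lead (lead i).+2).+3) m = 5.
Proof.
apply: (@iter_reach _ 5 10); first by vm_compute.
(* The outer [lead] loses at least 1 and the inner one at least 6, against the 2 and 3 that are
   added. *)
move=> i le_i; have := @leq_lead_sub 1 2 (lead i).+2.
by have := @leq_lead_sub 6 4 i; have := lead_gt0 i.-1; rewrite prednK; lia.
Qed.

(** * The first runs of an orbit *)

Definition four_runs : seq bool :=
  [:: true; false; true; true; true; true; false].

Section FirstRuns.
Variable S : nat -> bool.
Hypothesis hS : not_eventually_constant S.
Notation K n := (iter n knave S).

Let hK n : not_eventually_constant (K n).
Proof. exact: not_eventually_constant_iter. Qed.

Lemma starts_iter_lead i n m : starts (rcons (nseq m.+1 true) false) (K n) ->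
  starts (rcons (nseq (iter i lead m.+1) true) false) (K (i + n)).
Proof.
move=> st; have pos j : 0 < iter j lead m.+1.
  by elim: j => //= j; case: (iter j lead _) => // l _; exact: lead_gt0.
elim: i => //= i; case: (iter i lead m.+1) (pos i) => // l _.
apply: starts_transfer => // X; exact: (@prefix_knave_string_lead [::]).
Qed.

Lemma starts_10 : exists n, starts [:: true; false] (K n).
Proof.
have st1 : starts [:: true] (K 1).
  have st0 : starts [:: S 0] S by case.
  have [m stm] := starts_run (s := [::]) hS st0.
  apply: starts_transfer stm => // X /prefixP[u ->] /=.
  have [t ->] := knave_string_head (S 0) (rcons (nseq m (S 0)) (~~ S 0) ++ u).
  by case: t.
have [m stm] := starts_run (s := [::]) (@hK _) st1.
have [n eq1] := iter_lead m; exists (n + 1).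
by have := starts_iter_lead (i := n) stm; rewrite eq1.
Qed.

(** The image of 10 is 10 11, whose last two 1s join the leading 1s of the next block. *)
Lemma starts_iter_lead_add2 i n m :
    starts (rcons ([:: true; false] ++ nseq m.+1 true) false) (K n) ->
  starts (rcons ([:: true; false] ++
     nseq (iter i (fun j => (lead j).+2) m.+1) true) false) (K (i + n)).
Proof.
move=> st; have pos j : 0 < iter j (fun j => (lead j).+2) m.+1 by case: j.
elim: i => // i; rewrite iterS; case: (iter i _ m.+1) (pos i) => // l _.
apply: starts_transfer => // X.
exact: (@prefix_knave_string_lead [:: true; false]).
Qed.

Lemma starts_1011110 : exists n m,
  starts (rcons (four_runs ++ nseq m.+1 true) false) (K n).
Proof.
have [n st] := starts_10.
have {}st : starts [:: true; false; true] (K n.+1).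
  by apply: starts_transfer st => // X; exact: (@prefix_knave_string [::] true).
have [m {}st] := starts_run (s := [:: true; false]) (@hK _) st.
have [i eq3] := iter_lead_add2 m.+1.
have {st} := starts_iter_lead_add2 (i := i) st; rewrite eq3 => st.
(* The image of 10111 is 10 11 110, that is [four_runs], and the next block supplies the final 1. *)
have {}st : starts (rcons four_runs true) (K (i + n.+1).+1).
  apply: starts_transfer st => // X.
  exact: (@prefix_knave_string [:: true; false; true; true] true).
by have [l {}st] := starts_run (@hK _) st; exists (i + n.+1).+1, l.
Qed.

(** The image of [four_runs] is [u] followed by 11, and the image of [u] is [four_runs] followed by
    111; these 1s join the leading 1s of the next block. *)
Lemma starts_iter_lead_add3 i n m :
    starts (rcons (four_runs ++ nseq m.+1 true) false) (K n) ->
  starts (rcons (four_runs ++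
     nseq (iter i (fun j => (lead (lead j).+2).+3) m.+1) true) false)
    (K (i.*2 + n)).
Proof.
move=> st.
have pos j : 0 < iter j (fun j => (lead (lead j).+2).+3) m.+1 by case: j.
elim: i => // i; rewrite iterS; case: (iter i _ m.+1) (pos i) => // l _ sti.
pose u := [:: true; false; true; true; true; false; false; false].
have sti' : starts (rcons (u ++ nseq (lead l.+1).+2 true) false)
    (K (i.*2 + n).+1).
  apply: starts_transfer sti => // X.
  exact: (@prefix_knave_string_lead four_runs).
rewrite doubleS; apply: starts_transfer sti' => // X.
exact: (@prefix_knave_string_lead u).
Qed.

End FirstRuns.

(** Since 5 is a fixed point, three more double steps keep this beginning. They make the time at
    least 6, when the orbit of the string 1 also has it. *)
Lemma starts_four_runs5 S : not_eventually_constant S ->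
  exists n, starts (rcons (four_runs ++ nseq 5 true) false)
    (iter (n + 6) knave S).
Proof.
move=> hS; have [n [m st]] := starts_1011110 hS.
have [i eq5] := iter_lead_add3 m.+1; exists (i.*2 + n).
have {st} := starts_iter_lead_add3 hS (i := i) st; rewrite eq5 => st.
by have := starts_iter_lead_add3 hS (i := 3) st; rewrite addnC.
Qed.

(** * Growth of the common prefix, measured by runs of 1s *)

Lemma last_run s b : exists l rs, runs (rcons s b) = rcons rs (l.+1, b).
Proof.
elim: s => [|c s [l [rs def_rs]]]; first by exists 0, [::].
rewrite rcons_cons runs_cons def_rs.
case: rs {def_rs} => [|[k d] rs] /=; case: eqP => _.
- by exists l.+1, [::].
- by exists l, [:: (1, c)].
- by exists l, ((k.+1, d) :: rs).
- by exists l, [:: (1, c), (k, d) & rs].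
Qed.

Lemma runs_gt0 s : all (fun r => 0 < r.1) (runs s).
Proof.
elim: s => // b s; rewrite runs_cons.
case: (runs s) => // -[l c] rs /= /andP[l_gt0 all_rs].
by case: (b == c); rewrite /= ?l_gt0 all_rs.
Qed.

Lemma size_runs s : size (runs s) <= size s.
Proof.
elim: s => // b s; rewrite runs_cons; case: (runs s) => // -[l c] rs.
by case: (b == c) => //=; rewrite ?ltnS => // /ltnW.
Qed.

Definition true_runs (s : seq bool) : nat := count snd (runs s).

Lemma true_runs_cat s b t :
  true_runs (rcons s b ++ ~~ b :: t) =
  true_runs (rcons s b) + true_runs (~~ b :: t).
Proof. by rewrite /true_runs runs_cat count_cat. Qed.

(* The default [true] discounts a final 1, which is not yet a descent. *)
Fixpoint falls (s : seq bool) : nat :=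
  if s is b :: s' then (b && ~~ head true s') + falls s' else 0.

Lemma leq_falls_cat s t : falls s + falls t <= falls (s ++ t).
Proof.
elim: s => //= b s IHs; rewrite -addnA leq_add//.
by case: s {IHs} => //=; rewrite andbF.
Qed.

(** Each run of 1s ends in one descent 10, except a run at the very end of the string. *)
Lemma true_runs_falls s : true_runs s = falls s + last false s.
Proof.
elim: s => // b [|c s] IHs; first by rewrite /true_runs; case: b.
move: IHs; rewrite /true_runs (runs_cons b).
have [l [rs ->]] := runs_head c s.
by case: b; case: c => //= ->.
Qed.

Lemma falls_rcons_false s : (true \in s) <= falls (rcons s false).
Proof.
elim: s => // b s; rewrite inE rcons_cons [falls _]/=.
by case: b => //=; case: s => // -[].
Qed.

(** The block of a run of 1s starts with 1 and ends in 0, so it contains a descent. *)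
Lemma true_runs_knave_string s : true_runs s <= falls (knave_string s).
Proof.
rewrite /true_runs /knave_string.
elim: (runs s) (runs_gt0 s) => // -[[//|l] b] rs IHrs /IHrs {}IHrs.
apply: leq_trans (leq_falls_cat (knave_block l.+1 b) _); apply: leq_add => //.
case: b => //; apply: leq_trans (falls_rcons_false _).
by have [t ->] := binary_head l; rewrite inE eqxx.
Qed.

Lemma last_knave_string s b :
  exists t, knave_string (rcons s b) = rcons t (~~ b).
Proof.
have [l [rs def_rs]] := last_run s b.
rewrite /knave_string def_rs map_rcons flatten_rcons /knave_block -rcons_cat.
by eexists.
Qed.

Lemma prefix_rconsE (T : eqType) (s t : seq T) x :
  prefix s (rcons t x) = (s == rcons t x) || prefix s t.
Proof.
apply/idP/orP => [/prefixP[u]|[/eqP->|pre]]; last 2 first.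
- exact: prefix_refl.
- exact: prefix_trans pre (prefix_rcons _ _).
case/lastP: u => [|u y]; first by rewrite cats0 => ->; left.
by rewrite -rcons_cat => /rcons_inj[-> _]; right; exact: prefix_prefix.
Qed.

(** Normalises an image to the shape [w] 10: shortening the final run of 0s to one 0 loses no run of
    1s and keeps the given prefix. *)
Lemma strip_false p u : prefix (rcons (rcons p true) false) (rcons u false) ->
  exists w m, rcons u false = rcons w true ++ nseq m.+1 false /\
    prefix (rcons (rcons p true) false) (rcons (rcons w true) false).
Proof.
elim/last_ind: u => [|u [] IHu] pre.
- by case: p pre => [|[] []] //= b [|? ?].
- by exists u, 0; split=> //; rewrite cats1.
move: pre; rewrite prefix_rconsE => /orP[/eqP/rcons_inj[/rcons_inj[]]//|/IHu].
by move=> [w [m [-> pre]]]; exists w, m.+1; rewrite (cat_nseqS _ m.+1).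
Qed.

(** The part of [w] after [p] loses no run of 1s, so the gain is at least that of [p] alone: the
    descents in its image minus its own runs of 1s, stated here without subtraction. *)
Lemma common_prefix_step p p' w :
    prefix (rcons (rcons p true) false) (rcons (rcons w true) false) ->
    prefix (rcons (rcons p' true) false) (knave_string (rcons p true)) ->
  exists w',
    [/\ prefix (rcons (rcons p' true) false) (rcons (rcons w' true) false),
        true_runs (rcons w true) + falls (knave_string (rcons p true)) <=
          true_runs (rcons w' true) + true_runs (rcons p true) &
        forall X, prefix (rcons (rcons w true) false) X ->
          prefix (rcons (rcons w' true) false) (knave_string X)].
Proof.
move=> pre pre'.
(* [t] is what follows [rcons p true]; it is empty or begins with 0, so the cut falls between two
   runs. *)
have [t [runs_w kn_w]] : exists t,
    true_runs (rcons w true) = true_runs (rcons p true) + true_runs t /\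
    knave_string (rcons w true) = knave_string (rcons p true) ++ knave_string t.
  move: pre; rewrite prefix_rconsE => /orP[/eqP/rcons_inj[<-]|].
    by exists [::]; rewrite addn0 cats0.
  move=> /prefixP[t ->]; exists (false :: t).
  by rewrite cat_rcons (true_runs_cat _ true) (knave_string_cat _ true).
have [u def_u] := last_knave_string w true.
have pre_u : prefix (rcons (rcons p' true) false) (rcons u false).
  by rewrite -def_u kn_w; apply: prefix_trans pre' (prefix_prefix _ _).
have [w' [m [def_w' pre_w']]] := strip_false pre_u.
exists w'; split=> //.
  have falls_w' : falls (knave_string (rcons w true)) =
      true_runs (rcons w' true).
    have -> : true_runs (rcons w' true) =
        true_runs (knave_string (rcons w true)).
      rewrite def_u def_w' (true_runs_cat _ true) {3}/true_runs.
      by rewrite -[_ :: _]/(nseq m.+1 false) runs_nseq addn0.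
    by rewrite true_runs_falls def_u last_rcons addn0.
  rewrite -falls_w' kn_w runs_w.
  have := leq_falls_cat (knave_string (rcons p true)) (knave_string t).
  by have := true_runs_knave_string t; lia.
move=> X /prefix_knave_string; rewrite def_u def_w'.
apply: prefix_trans; apply: prefix_trans (prefix_rcons _ _).
by rewrite -[nseq _ _]/(false :: _) -cat_rcons prefix_prefix.
Qed.

(* The two alternating beginnings of an orbit, without their final 10. *)
Definition stem (b : bool) : seq bool :=
  if b then [:: true; false; true; true; true; false; false; false;
                true; true; true; false]
  else four_runs ++ nseq 4 true.

(** With its final 1, [stem b] has 3 runs of 1s for [false] and 4 for [true], while both images have
    4 descents: only the step from [stem false] gains a run. *)
Lemma stem_step b w :
    prefix (rcons (rcons (stem b) true) false) (rcons (rcons w true) false) ->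
  exists w',
    [/\ prefix (rcons (rcons (stem (~~ b)) true) false)
          (rcons (rcons w' true) false),
        true_runs (rcons w true) + ~~ b <= true_runs (rcons w' true) &
        forall X, prefix (rcons (rcons w true) false) X ->
          prefix (rcons (rcons w' true) false) (knave_string X)].
Proof.
move=> pre; have := @common_prefix_step (stem b) (stem (~~ b)) w pre.
case=> [|w' [pre' le_w' step]]; first by case: b {pre}; vm_compute.
exists w'; split=> //; move: le_w'.
have -> : falls (knave_string (rcons (stem b) true)) = 4.
  by case: (b); vm_compute.
have -> : true_runs (rcons (stem b) true) = b + 3 by case: (b); vm_compute.
by case: (b) => /=; lia.
Qed.

(** The stems alternate with the parity of [n], beginning with the gaining one; hence [uphalf n]
    runs of 1s, and at least as many bits. *)
Lemma common_prefix S T N : not_eventually_constant S ->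
    starts (rcons (rcons (stem false) true) false) (iter N knave S) ->
    prefix (rcons (rcons (stem false) true) false) (iter N knave_string T) ->
  forall n, exists w,
    [/\ uphalf n <= size w, starts w (iter (n + N) knave S) &
        prefix w (iter (n + N) knave_string T)].
Proof.
move=> hS stS preT n.
suff [w [_ le_n stw prew]] : exists w,
    [/\ prefix (rcons (rcons (stem (odd n)) true) false)
          (rcons (rcons w true) false),
        uphalf n <= true_runs (rcons w true),
        starts (rcons (rcons w true) false) (iter (n + N) knave S) &
        prefix (rcons (rcons w true) false) (iter (n + N) knave_string T)].
  exists (rcons (rcons w true) false); split=> //.
  apply: leq_trans le_n _; apply: leq_trans (count_size _ _) _.
  by apply: leq_trans (size_runs _) _; rewrite [X in _ <= X]size_rcons.
elim: n => [|n [w [pre le_n stw prew]]].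
  by exists (stem false); split=> //; exact: prefix_refl.
have [w' [pre' le_w' step]] := stem_step pre.
exists w'; split=> //.
- by apply: leq_trans le_w'; move: le_n; rewrite !uphalfE /= ; lia.
- by apply: starts_transfer stw => //; exact: not_eventually_constant_iter.
- exact: step.
Qed.

(** * Distances and the limit *)

Lemma dist_le (R : realType) s (S T : nat -> bool) :
  starts s S -> starts s T -> (dist R S T <= 2 ^- size s)%R.
Proof.
move=> stS stT; rewrite /dist; case: pselect => [h|_]; last first.
  by rewrite invr_ge0 exprn_ge0.
case: ex_minnP => m neq _; have le_m : size s <= m.
  by rewrite leqNgt; apply: contra neq => ltm; rewrite -stS// -stT.
rewrite lef_pV2 ?posrE ?exprn_gt0// ler_eXn2l ?ltr1n//; exact: leqW.
Qed.

Lemma dist_ge0 (R : realType) (S T : nat -> bool) : (0 <= dist R S T)%R.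
Proof.
by rewrite /dist; case: pselect => // h; rewrite invr_ge0 exprn_ge0.
Qed.

Local Open Scope classical_set_scope.
Local Open Scope ring_scope.

Lemma cvg_dist0 (R : realType) (S T : nat -> nat -> bool) (N : nat) :
    (forall n, exists w : seq bool,
      [/\ (uphalf n <= size w)%N, starts w (S (n + N)%N) &
        starts w (T (n + N)%N)]) ->
  dist R (S n) (T n) @[n --> \oo] --> (0 : R).
Proof.
move=> common; apply/cvgr0Pnorm_lt => e e_gt0.
have [k _ /(_ k (leqnn k)) lt_e] := near_infty_natSinv_expn_lt (PosNum e_gt0).
(* From this index on, the common prefix has at least [k] bits. *)
exists (k.*2 + N)%N => // n /= le_n.
have le_N : (N <= n)%N by lia.
have [w [le_w]] := common (n - N)%N; rewrite subnK// => stS stT.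
rewrite ger0_norm ?dist_ge0//; apply: le_lt_trans (dist_le R stS stT) _.
apply: le_lt_trans lt_e; rewrite div1r lef_pV2 ?posrE ?exprn_gt0//.
rewrite ler_eXn2l ?ltr1n//; apply: leq_trans le_w.
by rewrite uphalfE geq_half_double; lia.
Qed.

Theorem theorem4 (R : realType) (S : nat -> bool)
    (hS : not_eventually_constant S) :
  (dist R (iter n knave S) (extend (iter n knave_string [:: true]))
     @[n --> \oo] --> (0 : R)) \/
  (dist R (iter n knave S) (extend (iter n knave_string [:: true; false]))
     @[n --> \oo] --> (0 : R)).
Proof.
have common T N :
    starts (rcons (rcons (stem false) true) false) (iter N knave S) ->
    prefix (rcons (rcons (stem false) true) false) (iter N knave_string T) ->
    dist R (iter n knave S) (extend (iter n knave_string T)) @[n --> \oo] -->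
      (0 : R).
  move=> stS preT; apply: (cvg_dist0 (N := N)) => n.
  have [w [le_w stw prew]] := common_prefix hS stS preT n.
  by exists w; split=> //; exact: starts_extend.
have [N stN] := starts_four_runs5 hS.
(* Time 6 is computed; two steps of the stems then lead back to the same beginning. *)
have persist j : prefix (rcons (rcons (stem false) true) false)
    (iter (j.*2 + 6) knave_string [:: true]).
  elim: j => [|j IHj]; first by vm_compute.
  have [w [pre _ step]] :=
    stem_step (prefix_refl (rcons (rcons (stem false) true) false)).
  have [w' [pre' _ step']] := stem_step pre.
  by apply: prefix_trans pre' _; apply/step'/step.
case: (boolP (odd N)) => oddN; [right | left]; apply: common stN _.
  (* For odd [N] the orbit of 10, one step ahead of that of 1, has the beginning at time [N + 6],
     because [N + 7] is even. *)
  have -> : [:: true; false] = knave_string [:: true] by vm_compute.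
  rewrite -iterSr.
  have -> : (N + 6).+1 = (uphalf N).*2 + 6; last exact: persist.
  by rewrite uphalfE; lia.
have -> : (N + 6)%N = (N./2.*2 + 6)%N; last exact: persist.
by rewrite -[in LHS](odd_double_half N) (negPf oddN).
Qed.
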